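(* Put $U=u^2/2$ and $$w_+(u)=\sum_{k\ge 0}\mathsf w_{-k}U^{-k-1},\quad w_-(u)=\sum_{k\ge 0}\mathsf w_{k+1}U^{-k-1},\quad g_+(u)=\sum_{k\ge 0}\mathsf g_{k+1}U^{-k-1},\quad g_-(u)=\sum_{k\ge 0}\tilde{\mathsf g}_{k+1}U^{-k-1},$$ $$B(u)=\frac12\begin{pmatrix}\frac14\, g_-(u) & u\,w_-(u)\\ u\,w_+(u)&\frac14\, g_+(u)\end{pmatrix}.$$ Then the algebra $\bar{\mathcal A}$ admits the following FRT type presentation: it is the unital associative $\mathbb K$-algebra generated by $\{\mathsf w_{-k},\mathsf w_{k+1},\mathsf g_{k+1},\tilde{\mathsf g}_{k+1}\mid k\in\mathbb N\}$ with defining relations given by the coefficients of the non-standard classical Yang–Baxter algebra relation $$[B_1(u),B_2(v)]=[\bar r_{21}(v,u),B_1(u)]+[B_2(v),\bar r_{12}(u,v)].$$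
   Context: $\mathbb K$ is an algebraically closed field of characteristic $0$, $\mathbb N=\{0,1,2,\dots\}$, $[x,y]=xy-yx$. $\bar{\mathcal A}$ is the unital associative $\mathbb K$-algebra with generators $\mathsf w_{-k},\mathsf w_{k+1},\mathsf g_{k+1},\tilde{\mathsf g}_{k+1}$ ($k\in\mathbb N$) and relations, for all $k,\ell\in\mathbb N$: $[\mathsf w_{-\ell},\mathsf w_{k+1}]=\frac12(\tilde{\mathsf g}_{k+\ell+1}-\mathsf g_{k+\ell+1})$; $[\tilde{\mathsf g}_{k+1},\mathsf w_{-\ell}]=[\mathsf w_{-\ell},\mathsf g_{k+1}]=16\,\mathsf w_{-k-\ell-1}$; $[\mathsf w_{\ell+1},\tilde{\mathsf g}_{k+1}]=[\mathsf g_{k+1},\mathsf w_{\ell+1}]=16\,\mathsf w_{\ell+k+2}$; $[\mathsf w_{-k},\mathsf w_{-\ell}]=[\mathsf w_{k+1},\mathsf w_{\ell+1}]=[\mathsf g_{k+1},\mathsf g_{\ell+1}]=[\tilde{\mathsf g}_{k+1},\tilde{\mathsf g}_{\ell+1}]=0$. The $r$-matrix is, in the ordered basis $e_1\otimes e_1,e_1\otimes e_2,e_2\otimes e_1,e_2\otimes e_2$, $$\bar r_{12}(u,v)=\bar r(u,v)=\frac{1}{u^2/v^2-1}\begin{pmatrix}1&0&0&0\\0&-1&2u/v&0\\0&2u/v&-1&0\\0&0&0&1\end{pmatrix},$$ and $\bar r_{21}(u,v)=P\bar r_{12}(u,v)P=\bar r_{12}(u,v)$, with $P$ the flip. $B_1(u)=B(u)\otimes\mathbb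 I$, $B_2(v)=\mathbb I\otimes B(v)$. The matrix relation is understood after clearing the denominator $u^2-v^2$, comparing coefficients of the formal series in $u^{-1},v^{-1}$. *)

(* Defs.v *)
From HB Require Import structures.
From mathcomp Require Import all_boot all_order all_algebra.
From mathcomp Require Import ring.
From mathcomp Require Import finmap.
From mathcomp Require Import boolp.
From mathcomp.real_closed Require Import mxtens.
From mathcomp.multinomials Require Import monalg.

Set Implicit Arguments.
Unset Strict Implicit.
Unset Printing Implicit Defensive.

Import GRing.Theory.
Local Open Scope ring_scope.
Local Open Scope quotient_scope.

Lemma malg_scaleAr (R : comNzRingType) (M : monomType) (c : R)
  (p q : {malg R[M]}) : c *: (p * q) = p * (c *: q).
Proof.
apply/malgP => m; rewrite mcoeffZ !mcoeffMl mulr_sumr.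
apply: eq_bigr => k1 _.
rewrite (big_fset_incl _ (msuppZ_le c q)) /=; last first.
  by move=> x _ /mcoeff_outdom ->; rewrite mulr0 mul0rn.
rewrite mulr_sumr; apply: eq_bigr => k2 _.
by rewrite mcoeffZ mulrnAr mulrCA.
Qed.

Definition comm (R : nzRingType) (x y : R) : R := x * y - y * x.

Lemma morph_comm (R : nzRingType) (S : comNzRingType) (f : R -> S) :
  {morph f : x y / x - y} -> {morph f : x y / x * y} ->
  forall x y, f (comm x y) = 0.
Proof. by move=> fB fM x y; rewrite fB !fM mulrC subrr. Qed.

Lemma malgUZ (R : nzRingType) (M : monomType) (c : R) (m : M) :
  << c *g m >> = c *: << 1 *g m >> :> {malg R[M]}.
Proof. by apply/malgP => k; rewrite mcoeffZ !mcoeffU mulrnAr mulr1. Qed.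

Section FreeAlgebra.
Variables (K : fieldType) (I : choiceType).

(* The free unital associative K-algebra on I: the algebra of the free monoid. *)
Definition falg : Type := {malg K[{fmonom I}]}.

HB.instance Definition _ := GRing.Lalgebra.on falg.
HB.instance Definition _ :=
  GRing.Lalgebra_isAlgebra.Build K falg (@malg_scaleAr K _).

Definition fgen (i : I) : falg := << 1 *g fmu i >>.

Definition falg_eval (A : algType K) (x : I -> A) (p : falg) : A :=
  \sum_(m <- msupp p) p@_m *: \prod_(i <- fmonom_val m) x i.

Definition falg_cst (p : falg) : K :=
  mcoeff (fmone I) (p : {malg K[{fmonom I}]}).

Lemma falg_cst1 : falg_cst 1 = 1.
Proof. exact: (malgCK (K := {fmonom I}) (1 : K)). Qed.

Lemma falg_cstB p q : falg_cst (p - q) = falg_cst p - falg_cst q.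
Proof. exact: mcoeffB. Qed.

Lemma falg_cstM p q : falg_cst (p * q) = falg_cst p * falg_cst q.
Proof. exact: (mcoeff1g_is_multiplicative (fmonom I) K).1. Qed.

Lemma falg_cst_comm p q : falg_cst (comm p q) = 0.
Proof. exact: (morph_comm falg_cstB falg_cstM). Qed.

Lemma falg_cstZ (c : K) p : falg_cst (c *: p) = c * falg_cst p.
Proof. exact: mcoeffZ. Qed.

Lemma falg_cst_gen i : falg_cst (fgen i) = 0.
Proof.
rewrite /falg_cst /fgen mcoeffU; case: eqP => // /(congr1 (@fdeg I)).
by rewrite fdegU (fdeg1 (I := I)).
Qed.

End FreeAlgebra.

Section Quotient.
Variables (K : fieldType) (F : algType K).

(* rel l r stands for the relation l = r; rel_ideal is the two-sided ideal
   generated by the differences l - r. *)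
Variable rel : F -> F -> Prop.

Definition rel_ideal (p : F) : Prop :=
  exists (n : nat) (a b l r : 'I_n -> F),
    (forall i, rel (l i) (r i)) /\ p = \sum_i a i * (l i - r i) * b i.

Lemma rel_ideal0 : rel_ideal 0.
Proof.
exists 0, (fun=> 0), (fun=> 0), (fun=> 0), (fun=> 0).
by split; [case | rewrite big_ord0].
Qed.

Lemma rel_idealD p q : rel_ideal p -> rel_ideal q -> rel_ideal (p + q).
Proof.
move=> [n [a [b [l [r [h ->]]]]]] [n' [a' [b' [l' [r' [h' ->]]]]]].
pose g (f : 'I_n -> F) (f' : 'I_n' -> F) (i : 'I_(n + n')) :=
  match split i with inl j => f j | inr j => f' j end.
exists (n + n')%N, (g a a'), (g b b'), (g l l'), (g r r'); split.
  by move=> i; rewrite /g; case: split.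
rewrite big_split_ord; congr (_ + _); apply: eq_bigr => i _; rewrite /g.
  by rewrite -[lshift _ _]/(unsplit (inl i)) unsplitK.
by rewrite -[rshift _ _]/(unsplit (inr i)) unsplitK.
Qed.

Lemma rel_idealMl c p : rel_ideal p -> rel_ideal (c * p).
Proof.
move=> [n [a [b [l [r [h ->]]]]]]; exists n, (fun i => c * a i), b, l, r.
by split=> //; rewrite mulr_sumr; apply: eq_bigr => i _; rewrite !mulrA.
Qed.

Lemma rel_idealMr c p : rel_ideal p -> rel_ideal (p * c).
Proof.
move=> [n [a [b [l [r [h ->]]]]]]; exists n, a, (fun i => b i * c), l, r.
by split=> //; rewrite mulr_suml; apply: eq_bigr => i _; rewrite !mulrA.
Qed.

Lemma rel_idealN p : rel_ideal p -> rel_ideal (- p).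
Proof. by rewrite -mulN1r; apply: rel_idealMl. Qed.

Lemma rel_idealZ (c : K) p : rel_ideal p -> rel_ideal (c *: p).
Proof. by rewrite -[p in c *: p]mul1r scalerAl; apply: rel_idealMl. Qed.

Lemma rel_ideal_rel l r : rel l r -> rel_ideal (l - r).
Proof.
move=> h; exists 1, (fun=> 1), (fun=> 1), (fun=> l), (fun=> r).
by split=> //; rewrite big_ord1 mul1r mulr1.
Qed.

Definition rel_eqb (p q : F) : bool := `[< rel_ideal (p - q) >].

Lemma rel_eqb_equiv : equiv_class_of rel_eqb.
Proof.
split=> [p | p q | q p r].
- by apply/asboolP; rewrite subrr; exact: rel_ideal0.
- by apply/asboolP/asboolP => /rel_idealN; rewrite opprB.
- move=> /asboolP h1 /asboolP h2; apply/asboolP.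
  by rewrite -(subrKA q); exact: rel_idealD.
Qed.

Canonical rel_equiv := EquivRelPack rel_eqb_equiv.

(* MathComp algebras are nontrivial (1 != 0), hence the properness argument. *)
Definition quot_alg of ~ rel_ideal 1 : Type := {eq_quot rel_equiv}.

Hypothesis proper : ~ rel_ideal 1.
Notation Q := (quot_alg proper).

HB.instance Definition _ := Choice.on Q.
HB.instance Definition _ := EqQuotient.on Q.

Lemma pi_eqP (p q : F) : (\pi_Q p = \pi_Q q) <-> rel_ideal (p - q).
Proof. by split=> [/eqmodP/asboolP | h] //; apply/eqmodP/asboolP. Qed.

Definition Qzero : Q := \pi_Q 0.
Definition Qone : Q := \pi_Q 1.
Definition Qopp : Q -> Q := locked (fun x => \pi_Q (- repr x)).
Definition Qadd : Q -> Q -> Q := locked (fun x y => \pi_Q (repr x + repr y)).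
Definition Qmul : Q -> Q -> Q := locked (fun x y => \pi_Q (repr x * repr y)).
Definition Qscale : K -> Q -> Q := locked (fun c x => \pi_Q (c *: repr x)).

Lemma repr_pi (p : F) : rel_ideal (repr (\pi_Q p) - p).
Proof. by apply/pi_eqP; rewrite reprK. Qed.

Lemma Qopp_pi p : Qopp (\pi p) = \pi_Q (- p).
Proof.
rewrite /Qopp -lock; apply/pi_eqP; rewrite -opprD.
exact/rel_idealN/repr_pi.
Qed.

Lemma Qadd_pi p q : Qadd (\pi p) (\pi q) = \pi_Q (p + q).
Proof.
rewrite /Qadd -lock; apply/pi_eqP; rewrite opprD addrACA.
by apply: rel_idealD; exact: repr_pi.
Qed.

Lemma Qmul_pi p q : Qmul (\pi p) (\pi q) = \pi_Q (p * q).
Proof.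
rewrite /Qmul -lock; apply/pi_eqP; set p' := repr _; set q' := repr _.
rewrite -(subrKA (p * q')) -mulrBl -mulrBr; apply: rel_idealD.
  by apply/rel_idealMr/repr_pi.
by apply/rel_idealMl/repr_pi.
Qed.

Lemma Qscale_pi c p : Qscale c (\pi p) = \pi_Q (c *: p).
Proof.
rewrite /Qscale -lock; apply/pi_eqP; rewrite -scalerBr.
exact/rel_idealZ/repr_pi.
Qed.

Lemma quot_piP (x : Q) : exists p, x = \pi_Q p.
Proof. by exists (repr x); rewrite reprK. Qed.

Fact QaddA : associative Qadd.
Proof.
move=> x y z; have [p ->] := quot_piP x; have [q ->] := quot_piP y.
by have [r ->] := quot_piP z; rewrite !Qadd_pi addrA.
Qed.

Fact QaddC : commutative Qadd.
Proof.
move=> x y; have [p ->] := quot_piP x; have [q ->] := quot_piP y.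
by rewrite !Qadd_pi addrC.
Qed.

Fact Qadd0 : left_id Qzero Qadd.
Proof. by move=> x; have [p ->] := quot_piP x; rewrite !Qadd_pi add0r. Qed.

Fact QaddN : left_inverse Qzero Qopp Qadd.
Proof.
by move=> x; have [p ->] := quot_piP x; rewrite Qopp_pi !Qadd_pi addNr.
Qed.

HB.instance Definition _ := GRing.isZmodule.Build Q QaddA QaddC Qadd0 QaddN.

Lemma quot_piD p q : \pi_Q (p + q) = \pi_Q p + \pi_Q q.
Proof. by rewrite -Qadd_pi. Qed.

Fact QmulA : associative Qmul.
Proof.
move=> x y z; have [p ->] := quot_piP x; have [q ->] := quot_piP y.
by have [r ->] := quot_piP z; rewrite !Qmul_pi mulrA.
Qed.

Fact Qmul1 : left_id Qone Qmul.
Proof. by move=> x; have [p ->] := quot_piP x; rewrite !Qmul_pi mul1r. Qed.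

Fact Q1mul : right_id Qone Qmul.
Proof. by move=> x; have [p ->] := quot_piP x; rewrite !Qmul_pi mulr1. Qed.

Fact QmulDl : left_distributive Qmul +%R.
Proof.
move=> x y z; have [p ->] := quot_piP x; have [q ->] := quot_piP y.
by have [r ->] := quot_piP z; rewrite -quot_piD !Qmul_pi -quot_piD mulrDl.
Qed.

Fact QmulDr : right_distributive Qmul +%R.
Proof.
move=> x y z; have [p ->] := quot_piP x; have [q ->] := quot_piP y.
by have [r ->] := quot_piP z; rewrite -quot_piD !Qmul_pi -quot_piD mulrDr.
Qed.

Fact Q1neq0 : Qone != 0.
Proof. by apply/eqP => /pi_eqP; rewrite subr0. Qed.

HB.instance Definition _ :=
  GRing.Zmodule_isNzRing.Build Q QmulA Qmul1 Q1mul QmulDl QmulDr Q1neq0.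

Fact QscaleA a b (x : Q) : Qscale a (Qscale b x) = Qscale (a * b) x.
Proof. by have [p ->] := quot_piP x; rewrite !Qscale_pi scalerA. Qed.

Fact Qscale1 : left_id 1 Qscale.
Proof. by move=> x; have [p ->] := quot_piP x; rewrite !Qscale_pi scale1r. Qed.

Fact QscaleDr : right_distributive Qscale +%R.
Proof.
move=> c x y; have [p ->] := quot_piP x; have [q ->] := quot_piP y.
by rewrite -quot_piD !Qscale_pi -quot_piD scalerDr.
Qed.

Fact QscaleDl (x : Q) : {morph Qscale^~ x : a b / a + b}.
Proof.
move=> a b; have [p ->] := quot_piP x.
by rewrite !Qscale_pi -quot_piD scalerDl.
Qed.

HB.instance Definition _ :=
  GRing.Zmodule_isLmodule.Build K Q QscaleA Qscale1 QscaleDr QscaleDl.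

Lemma quot_pi1 : \pi_Q 1 = 1.
Proof. by []. Qed.

Lemma quot_piM p q : \pi_Q (p * q) = \pi_Q p * \pi_Q q.
Proof. by rewrite -Qmul_pi. Qed.

Lemma quot_piZ c p : \pi_Q (c *: p) = c *: \pi_Q p.
Proof. by rewrite -Qscale_pi. Qed.

Fact QscaleAl (c : K) (x y : Q) : c *: (x * y) = (c *: x) * y.
Proof.
have [p ->] := quot_piP x; have [q ->] := quot_piP y.
by rewrite -!(quot_piM, quot_piZ) scalerAl.
Qed.

HB.instance Definition _ := GRing.Lmodule_isLalgebra.Build K Q QscaleAl.

Fact QscaleAr (c : K) (x y : Q) : c *: (x * y) = x * (c *: y).
Proof.
have [p ->] := quot_piP x; have [q ->] := quot_piP y.
by rewrite -!(quot_piM, quot_piZ) scalerAr.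
Qed.

HB.instance Definition _ := GRing.Lalgebra_isAlgebra.Build K Q QscaleAr.

Lemma quot_pi0 : \pi_Q 0 = 0.
Proof. by []. Qed.

End Quotient.

Section Presentation.
Variables (K : fieldType) (I : choiceType).
Variable rel : falg K I -> falg K I -> Prop.

Definition presented_by (A : algType K) (x : I -> A) : Prop :=
  (forall a : A, exists p, falg_eval x p = a) /\
  (forall p, falg_eval x p = 0 <-> rel_ideal rel p).

Lemma rel_ideal_proper :
  (forall l r, rel l r -> falg_cst l = falg_cst r) -> ~ rel_ideal rel 1.
Proof.
move=> h [n [a [b [l [r [hlr /(congr1 (@falg_cst K I))]]]]]].
have cst0 : falg_cst (0 : falg K I) = 0 by rewrite -(subrr 0) falg_cstB subrr.
rewrite falg_cst1; suff -> : falg_cst (\sum_i a i * (l i - r i) * b i) = 0.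
  by move/eqP; rewrite oner_eq0.
apply: (big_ind (fun p => falg_cst p = 0)) => // [p q p0 q0 | i _].
  by rewrite -[q]opprK falg_cstB p0 -sub0r falg_cstB q0 cst0 !subr0.
by rewrite !falg_cstM falg_cstB (h _ _ (hlr i)) subrr mulr0 mul0r.
Qed.

Variable proper : ~ rel_ideal rel 1.

Definition quot_gen (i : I) : quot_alg proper :=
  \pi_(quot_alg proper) (fgen K i).

Lemma quot_evalE (p : falg K I) : falg_eval quot_gen p = \pi_(quot_alg proper) p.
Proof.
have hm (m : {fmonom I}) :
    \prod_(i <- fmonom_val m) quot_gen i =
      \pi_(quot_alg proper) (<< 1 *g m >> : falg K I).
  case: m => s; elim: s => [|i s IHs].
    by rewrite big_nil -fmoneE -quot_pi1.
  rewrite big_cons IHs /quot_gen -quot_piM; congr (\pi_(quot_alg proper) _).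
  by rewrite /fgen [LHS]fgmulUU mulr1 fmuE /mmul /= fmmulE.
rewrite [in RHS](monalgE p) /falg_eval.
rewrite (big_morph (fun q : falg K I => \pi_(quot_alg proper) q)
  (@quot_piD _ _ _ proper) (@quot_pi0 _ _ _ proper)).
apply: eq_bigr => m _; rewrite hm -quot_piZ; congr (\pi_(quot_alg proper) _).
exact/esym/malgUZ.
Qed.

Lemma quot_alg_presented : presented_by quot_gen.
Proof.
split=> [a | p].
  by have [p ->] := quot_piP a; exists p; rewrite quot_evalE.
by rewrite quot_evalE -quot_pi0 pi_eqP subr0.
Qed.

End Presentation.

(* Wm k, Wp k, Gg k, Gt k stand for w_{-k}, w_{k+1}, g_{k+1}, g~_{k+1}. *)
Inductive gen := Wm of nat | Wp of nat | Gg of nat | Gt of nat.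

Definition gen_code (x : gen) : 'I_4 * nat :=
  match x with
  | Wm k => (inord 0, k) | Wp k => (inord 1, k)
  | Gg k => (inord 2, k) | Gt k => (inord 3, k)
  end.

Definition gen_decode (c : 'I_4 * nat) : gen :=
  match val c.1 with
  | 0 => Wm c.2 | 1 => Wp c.2 | 2 => Gg c.2 | _ => Gt c.2
  end.

Lemma gen_codeK : cancel gen_code gen_decode.
Proof. by case=> k; rewrite /gen_decode /= inordK. Qed.

HB.instance Definition _ := Countable.copy gen (can_type gen_codeK).

Section AbarRelations.
Variables (K : fieldType) (F : algType K) (x : gen -> F).
Notation wm k := (x (Wm k)).
Notation wp k := (x (Wp k)).
Notation g k := (x (Gg k)).
Notation gt k := (x (Gt k)).

Inductive abar_rel : F -> F -> Prop :=
| abar_wm_wp k l :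
    abar_rel (comm (wm l) (wp k)) (2^-1 *: (gt (k + l) - g (k + l)))
| abar_gt_wm k l : abar_rel (comm (gt k) (wm l)) (16 *: wm (k + l + 1))
| abar_wm_g k l : abar_rel (comm (wm l) (g k)) (16 *: wm (k + l + 1))
| abar_wp_gt k l : abar_rel (comm (wp l) (gt k)) (16 *: wp (l + k + 1))
| abar_g_wp k l : abar_rel (comm (g k) (wp l)) (16 *: wp (l + k + 1))
| abar_wm_wm k l : abar_rel (comm (wm k) (wm l)) 0
| abar_wp_wp k l : abar_rel (comm (wp k) (wp l)) 0
| abar_g_g k l : abar_rel (comm (g k) (g l)) 0
| abar_gt_gt k l : abar_rel (comm (gt k) (gt l)) 0.

End AbarRelations.

Section Abar.
Variable K : fieldType.
Notation F := (falg K gen).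

Lemma abar_proper : ~ rel_ideal (abar_rel (@fgen K gen)) 1.
Proof.
apply: rel_ideal_proper => l r.
have cst0 : falg_cst (0 : F) = 0 by rewrite -(subrr 0) falg_cstB subrr.
by case=> *; rewrite falg_cst_comm ?falg_cstZ ?falg_cstB ?falg_cst_gen ?subrr
  ?mulr0.
Qed.

Definition abar : algType K := quot_alg abar_proper.
Definition abar_gen : gen -> abar := quot_gen abar_proper.

Lemma abar_presented : presented_by (abar_rel (@fgen K gen)) abar_gen.
Proof. exact: quot_alg_presented. Qed.

End Abar.

Section RMatrix.
Variable L : fieldType.

(* 'I_(2 * 2) is ordered as in tensmx: e1 (x) e1, e1 (x) e2, e2 (x) e1,
   e2 (x) e2. *)
Definition rbar (u v : L) : 'M[L]_(2 * 2) :=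
  (u ^+ 2 / v ^+ 2 - 1)^-1 *:
  \matrix_(i, j) nth 0 (nth [::]
    [:: [:: 1;  0;             0;             0];
        [:: 0; -1;             2 * (u / v);   0];
        [:: 0;  2 * (u / v);  -1;             0];
        [:: 0;  0;             0;             1]] i) j.

Definition flip : 'M[L]_(2 * 2) :=
  \matrix_(i, j) (mxtens_unindex i == ((mxtens_unindex j).2,
                                       (mxtens_unindex j).1) :> 'I_2 * 'I_2)%:R.

Definition rbar21 (u v : L) : 'M[L]_(2 * 2) := flip *m rbar u v *m flip.

Lemma rbar21E u v : rbar21 u v = rbar u v.
Proof.
apply/matrixP => i j; rewrite /rbar21 /flip /rbar !mxE.
rewrite !big_ord_recl big_ord0 !mxE !big_ord_recl !big_ord0 !mxE.
by case: i => [[|[|[|[|//]]]] ?]; case: j => [[|[|[|[|//]]]] ?] /=;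
  rewrite ?(mul0r, mulr0, add0r, addr0, mul1r, mulr1).
Qed.

End RMatrix.

Definition rbar_num (R : comNzRingType) (s u v : R) : 'M[R]_(2 * 2) :=
  s *: \matrix_(i, j) nth 0 (nth [::]
    [:: [:: v ^+ 2;  0;             0;            0];
        [:: 0;      - v ^+ 2;       2 * (u * v);  0];
        [:: 0;       2 * (u * v); - v ^+ 2;       0];
        [:: 0;       0;             0;            v ^+ 2]] i) j.

Lemma rbar_numE (L : fieldType) (u v : L) :
  u != 0 -> v != 0 -> u ^+ 2 - v ^+ 2 != 0 ->
  (u ^+ 2 - v ^+ 2) *: rbar u v = rbar_num 1 u v.
Proof.
move=> hu hv h; rewrite /rbar_num /rbar scale1r scalerA.
have -> : (u ^+ 2 - v ^+ 2) * (u ^+ 2 / v ^+ 2 - 1)^-1 = v ^+ 2.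
  by field; rewrite hv mulN1r h.
apply/matrixP => i j; rewrite !mxE.
by case: i => [[|[|[|[|//]]]] ?]; case: j => [[|[|[|[|//]]]] ?] /=;
  field; rewrite ?hv.
Qed.

Lemma map_rbar_num (R S : comNzRingType) (f : {rmorphism R -> S}) (s u v : R) :
  map_mx f (rbar_num s u v) = rbar_num (f s) (f u) (f v).
Proof.
apply/matrixP => i j; rewrite !mxE rmorphM; congr (_ * _).
case: i => [[|[|[|[|//]]]] ?]; case: j => [[|[|[|[|//]]]] ?] /=;
  by rewrite ?(rmorph0, rmorphN, rmorphM, rmorphXn) ?rmorph_nat.
Qed.

Section MapRMatrix.
Variables (R : comNzRingType) (L : fieldType) (f : {rmorphism R -> L}).
Variables u v : R.
Hypotheses (hu : f u != 0) (hv : f v != 0) (h : f u ^+ 2 - f v ^+ 2 != 0).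

Lemma map_rbar_num12 :
  map_mx f (rbar_num 1 u v) = (f u ^+ 2 - f v ^+ 2) *: rbar (f u) (f v).
Proof. by rewrite map_rbar_num rmorph1 rbar_numE. Qed.

Lemma map_rbar_num21 :
  map_mx f (rbar_num (-1) v u) = (f u ^+ 2 - f v ^+ 2) *: rbar21 (f v) (f u).
Proof.
rewrite map_rbar_num rmorphN1 rbar21E -opprB scaleNr rbar_numE //.
  by rewrite /rbar_num scaleN1r scale1r.
by rewrite -oppr_eq0 opprB.
Qed.

End MapRMatrix.

Section ClearedRMatrix.
Variable K : fieldType.

(* K[u, v]; the coefficient of u^a v^b in p is p`_b`_a. *)
Notation Kuv := {poly {poly K}}.
Definition pu : Kuv := ('X)%:P.
Definition pv : Kuv := 'X.
Definition fu : {fraction Kuv} := FracField.tofrac pu.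
Definition fv : {fraction Kuv} := FracField.tofrac pv.

(* N = (u^2 - v^2) r, with N polynomial and r rational. *)
Definition cleared (N : 'M[Kuv]_(2 * 2)) (r : 'M[{fraction Kuv}]_(2 * 2)) :=
  map_mx (@FracField.tofrac Kuv) N = (fu ^+ 2 - fv ^+ 2) *: r.

Lemma cleared_inj N N' r : cleared N r -> cleared N' r -> N = N'.
Proof.
move=> h h'; apply/matrixP => i j; apply/eqP; rewrite -tofrac_eq; apply/eqP.
by move/matrixP: (etrans h (esym h')) => /(_ i j); rewrite !mxE.
Qed.

Lemma fu_neq0 : fu != 0.
Proof. by rewrite tofrac_eq0 polyC_eq0 polyX_eq0. Qed.

Lemma fv_neq0 : fv != 0.
Proof. by rewrite tofrac_eq0 polyX_eq0. Qed.

Lemma fu2_neq_fv2 : fu ^+ 2 - fv ^+ 2 != 0.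
Proof.
rewrite -!tofracXn -tofracB tofrac_eq0; apply/eqP => /(congr1 (coefp 2)).
rewrite /= coefB coefXn /pu -rmorphXn /= coefC coef0 sub0r => /eqP.
by rewrite oppr_eq0 oner_eq0.
Qed.

Lemma cleared_rbar12 : cleared (rbar_num 1 pu pv) (rbar fu fv).
Proof. exact: (map_rbar_num12 fu_neq0 fv_neq0 fu2_neq_fv2). Qed.

Lemma cleared_rbar21 : cleared (rbar_num (-1) pv pu) (rbar21 fv fu).
Proof. exact: (map_rbar_num21 fu_neq0 fv_neq0 fu2_neq_fv2). Qed.

End ClearedRMatrix.

Section FRTRelations.
Variables (K : fieldType) (F : algType K) (x : gen -> F).

(* A function f : int -> V is the formal series sum_n (f n) u^n, and
   S : int -> int -> V is the formal series sum_(i, j) (S i j) u^i v^j. *)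

(* sum_(k >= 0) (y k) U^(- k - 1) where U = u^2 / 2, so that
   U^(- k - 1) = 2^(k + 1) u^(- 2 k - 2). *)
Definition Useries (y : nat -> F) (n : int) : F :=
  \sum_(k < `|n|%N | n == - (2 * (k%:Z + 1))) (2 ^+ k.+1 : K) *: y k.

Definition mulu (f : int -> F) (n : int) : F := f (n - 1).

Definition w_plus := Useries (fun k => x (Wm k)).
Definition w_minus := Useries (fun k => x (Wp k)).
Definition g_plus := Useries (fun k => x (Gg k)).
Definition g_minus := Useries (fun k => x (Gt k)).

Definition Bser (n : int) : 'M[F]_2 :=
  \matrix_(i, j) ((2^-1 : K) *: nth 0 (nth [::]
    [:: [:: (4^-1 : K) *: g_minus n; mulu w_minus n];
        [:: mulu w_plus n;           (4^-1 : K) *: g_plus n]] i) j).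

Definition B1 (i j : int) : 'M[F]_(2 * 2) :=
  if j == 0 then Bser i *t 1%:M else 0.
Definition B2 (i j : int) : 'M[F]_(2 * 2) :=
  if i == 0 then 1%:M *t Bser j else 0.

(* [B_1(u), B_2(v)]: as B_1 involves only u and B_2 only v, the coefficient of
   u^i v^j in a product of the two is a single product. *)
Definition commB1B2 (i j : int) : 'M[F]_(2 * 2) :=
  B1 i 0 *m B2 0 j - B2 0 j *m B1 i 0.

Definition pscale (p : {poly {poly K}}) (S : int -> int -> F) (i j : int) : F :=
  \sum_(b < size p) \sum_(a < size p`_b) p`_b`_a *: S (i - a%:Z) (j - b%:Z).

Definition mxser := int -> int -> 'M[F]_(2 * 2).

Definition pmull (N : 'M[{poly {poly K}}]_(2 * 2)) (S : mxser) : mxser :=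
  fun i j => \matrix_(r, s) \sum_t pscale (N r t) (fun a b => S a b t s) i j.

Definition pmulr (S : mxser) (N : 'M[{poly {poly K}}]_(2 * 2)) : mxser :=
  fun i j => \matrix_(r, s) \sum_t pscale (N t s) (fun a b => S a b r t) i j.

(* The (r, s) entry of the coefficient of u^i v^j in the relation
   [B_1(u), B_2(v)] = [rbar_21(v, u), B_1(u)] + [B_2(v), rbar_12(u, v)]
   multiplied by u^2 - v^2. *)
Variant frt_rel : F -> F -> Prop :=
| FRTRel (N12 N21 : 'M[{poly {poly K}}]_(2 * 2)) (i j : int) (r s : 'I_(2 * 2)) :
    cleared N12 (rbar (fu K) (fv K)) ->
    cleared N21 (rbar21 (fv K) (fu K)) ->
    frt_rel
      (pmull ((pu K ^+ 2 - pv K ^+ 2)%:M) commB1B2 i j r s)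
      (((pmull N21 B1 i j - pmulr B1 N21 i j)
        + (pmulr B2 N12 i j - pmull N12 B2 i j)) r s).

End FRTRelations.

(* Main.v *)
(* Entrywise, multiplying the defining relations of Abar by U^(-k-1) V^(-l-1)
   and summing gives formulas for the commutators of the entries of B(u) and
   B(v). The difference between the two sides of such a formula is a double
   series D in u^-1 and v^-1, and since
     (U - V) sum_(k + l = n) U^(-k-1) V^(-l-1) = V^(-n-1) - U^(-n-1),
   the corresponding entry of the cleared matrix relation says, up to a nonzero
   scalar, that (u^2 - v^2) D = 0. Multiplication by u^2 - v^2 is injective on
   series in u^-1 and v^-1, so each family of relations yields the other. The
   one commutator not covered by the defining relations, [g, g~] = 0, follows
   from them by the Jacobi identity. *)
Require Import Defs.
From mathcomp Require Import all_boot all_order all_algebra.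
From mathcomp Require Import ring zify.
From mathcomp.real_closed Require Import mxtens.

Set Implicit Arguments.
Unset Strict Implicit.
Unset Printing Implicit Defensive.

Import GRing.Theory Num.Theory Order.TTheory.
Local Open Scope ring_scope.
Local Open Scope quotient_scope.

(** * Comparison of ideals generated by relations *)

Section IdealInclusion.
Variables (K : fieldType) (F : algType K).

Lemma rel_ideal_sub (rel rel' : F -> F -> Prop) (p : F) :
  (forall l r, rel l r -> rel_ideal rel' (l - r)) ->
  rel_ideal rel p -> rel_ideal rel' p.
Proof.
move=> sub [n [a [b [l [r [h ->]]]]]].
apply: big_ind => [||i _]; [exact: rel_ideal0 | exact: rel_idealD |].
exact/rel_idealMr/rel_idealMl/sub.
Qed.

Lemma rel_idealB (rel : F -> F -> Prop) p q :
  rel_ideal rel p -> rel_ideal rel q -> rel_ideal rel (p - q).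
Proof. by move=> hp hq; apply/rel_idealD/rel_idealN. Qed.

(** This removes the powers of 2 and the coefficients of B that accompany each relation once it is
    read off from a series. *)
Lemma rel_ideal_scale (rel : F -> F -> Prop) (c : K) p :
  c != 0 -> rel_ideal rel (c *: p) -> rel_ideal rel p.
Proof. by move=> c0 /(rel_idealZ c^-1); rewrite scalerA mulVf // scale1r. Qed.

End IdealInclusion.

(** * Multiplication of double series by polynomials in u and v *)

Section PolynomialAction.
Variables (K : fieldType) (F : algType K).
Implicit Types (p q : {poly {poly K}}) (S : int -> int -> F).

(** Padding with zero coefficients gives a common range of summation to polynomials of different
    sizes, so that they can be subtracted termwise. *)
Lemma pscale_widen m n p S i j :
  (size p <= n)%N -> (forall b, (size (p`_b)%R <= m)%N) ->
  pscale p S i j = \sum_(b < n) \sum_(a < m) p`_b`_a *: S (i - a%:Z) (j - b%:Z).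
Proof.
move=> pn pm; rewrite /pscale.
rewrite (big_ord_widen n (fun b => \sum_(a < size p`_b)
  p`_b`_a *: S (i - a%:Z) (j - b%:Z))) // big_mkcond /=.
apply: eq_bigr => b _; case: ltnP => hb; last first.
  by rewrite big1 // => a _; rewrite (nth_default _ hb) coef0 scale0r.
rewrite (big_ord_widen m (fun a => p`_b`_a *: S (i - a%:Z) (j - b%:Z))) //.
rewrite big_mkcond; apply: eq_bigr => a _; case: ltnP => // ha.
by rewrite (nth_default _ ha) scale0r.
Qed.

Lemma pscale_bound p : exists N : nat,
  (size p <= N)%N /\ forall b, (size (p`_b)%R <= N)%N.
Proof.
exists (size p + \max_(b < size p) size (p`_b)%R)%N.
split; first exact: leq_addr.
move=> b; have [hb|hb] := ltnP b (size p); last first.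
  by rewrite (nth_default _ hb) size_poly0.
by rewrite (leq_trans _ (leq_addl _ _)) // (leq_bigmax (Ordinal hb)).
Qed.

Lemma pscaleB p q S i j :
  pscale (p - q) S i j = pscale p S i j - pscale q S i j.
Proof.
have [m [pm pm']] := pscale_bound p; have [n [qn qn']] := pscale_bound q.
have le1 k : (k <= m -> k <= m + n)%N by move/leq_trans; apply; exact: leq_addr.
have le2 k : (k <= n -> k <= m + n)%N by move/leq_trans; apply; exact: leq_addl.
have leB (R : nzRingType) (f g : {poly R}) :
    (size f <= m -> size g <= n -> size (f - g)%R <= m + n)%N.
  move=> hf hg; apply: leq_trans (size_polyD _ _) _.
  by rewrite size_polyN geq_max le1 ?le2.
rewrite (pscale_widen _ _ _ (le1 _ pm) (fun b => le1 _ (pm' b))).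
rewrite (pscale_widen _ _ _ (le2 _ qn) (fun b => le2 _ (qn' b))).
rewrite (@pscale_widen (m + n) (m + n)) ?leB // => [|b]; last first.
  by rewrite coefB leB.
rewrite -sumrB; apply: eq_bigr => b _; rewrite -sumrB; apply: eq_bigr => a _.
by rewrite !coefB scalerBl.
Qed.

Lemma pscale0 S i j : pscale 0 S i j = 0.
Proof. by rewrite /pscale size_poly0 big_ord0. Qed.

Lemma pscaleN p S i j : pscale (- p) S i j = - pscale p S i j.
Proof. by rewrite -[- p]sub0r pscaleB pscale0 sub0r. Qed.

Lemma pscaleX c a b S i j :
  pscale (c%:P%:P * (pu K ^+ a * pv K ^+ b)) S i j =
  c *: S (i - a%:Z) (j - b%:Z).
Proof.
have coefE b' a' : (c%:P%:P * (pu K ^+ a * pv K ^+ b))`_b'`_a' =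
    if (b' == b) && (a' == a) then c else 0.
  have -> : c%:P%:P * (pu K ^+ a * pv K ^+ b) = (c%:P * 'X^a)%:P * 'X^b.
    by rewrite /pu /pv mulrA polyCM rmorphXn.
  rewrite coefCM coefXn; case: eqP => _; rewrite ?mulr0 ?coef0 //= mulr1.
  by rewrite coefCM coefXn; case: eqP => _; rewrite ?mulr1 ?mulr0.
rewrite (@pscale_widen a.+1 b.+1).
- rewrite (bigD1 ord_max) //= (bigD1 ord_max) //= coefE !eqxx /=.
  rewrite !big1 ?addr0 // => [b' hb|a' ha]; last first.
    by rewrite coefE eqxx (negbTE (ha : a' != a :> nat)) scale0r.
  apply: big1 => a' _.
  by rewrite coefE (negbTE (hb : b' != b :> nat)) scale0r.
- apply/leq_sizeP => k hk; apply/polyP => a'; rewrite coefE coef0.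
  by rewrite gtn_eqF.
- move=> b'; apply/leq_sizeP => k hk; rewrite coefE.
  by rewrite [k == a]gtn_eqF ?andbF.
Qed.

End PolynomialAction.

(** * Commutators of the entries of B as double series *)

Section Entries.
Variables (K : fieldType) (F : algType K) (x : gen -> F).

(* [ent a c] is the family of generators in the entry (a, c) of B, where false
   and true number the rows and columns 1 and 2; that entry of B is the series
   [ser a c] times [ent_coef a c] u^(ent_shift a c). *)
Definition ent (a c : bool) : nat -> gen :=
  match a, c with
  | false, false => Gt | false, true => Wp
  | true, false => Wm | true, true => Gg
  end.

Definition ser (a c : bool) : int -> F := Useries (fun k => x (ent a c k)).

Definition ent_coef (a c : bool) : K := 2^-1 * (if a == c then 4^-1 else 1).

Definition ent_shift (a c : bool) : int := (a != c)%:Z.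

(* The value in Abar of the commutator of [ent a c k] and [ent b d l], as a
   function of m = k + l. *)
Definition bracket (a c b d : bool) (m : nat) : F :=
  match a, c, b, d with
  | true, false, false, true => 2^-1 *: (x (Gt m) - x (Gg m))
  | false, true, true, false => 2^-1 *: (x (Gg m) - x (Gt m))
  | false, false, true, false | true, false, true, true => 16 *: x (Wm (m + 1))
  | true, false, false, false | true, true, true, false => - 16 *: x (Wm (m + 1))
  | false, true, false, false | true, true, false, true => 16 *: x (Wp (m + 1))
  | false, false, false, true | false, true, true, true => - 16 *: x (Wp (m + 1))
  | _, _, _, _ => 0
  end.

(* The double series with coefficients [bracket (k + l)] at U^(-k-1) V^(-l-1)
   has coefficient [bracket_ser (i + j)] at u^i v^j, for i and j negative and
   even. *)
Definition bracket_ser (a c b d : bool) (n : int) : F :=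
  match a, c, b, d with
  | true, false, false, true => ser false false (n + 2) - ser true true (n + 2)
  | false, true, true, false => ser true true (n + 2) - ser false false (n + 2)
  | false, false, true, false | true, false, true, true => 16 *: ser true false n
  | true, false, false, false | true, true, true, false => - 16 *: ser true false n
  | false, true, false, false | true, true, false, true => 16 *: ser false true n
  | false, false, false, true | false, true, true, true => - 16 *: ser false true n
  | _, _, _, _ => 0
  end.

(** The guard selects the exponents of the terms U^(-k-1) V^(-l-1). It cannot be dropped:
    [bracket_ser] depends on i + j alone, and may be nonzero with i >= 0. *)
Definition defect (a c b d : bool) (i j : int) : F :=
  comm (ser a c i) (ser b d j) -
  (if [&& i < 0, j < 0, (2 %| i)%Z & (2 %| j)%Z]
   then bracket_ser a c b d (i + j) else 0).

Lemma Useries_even (y : nat -> F) (k : nat) :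
  Useries y (- (2 * (k%:Z + 1))) = 2 ^+ k.+1 *: y k.
Proof.
rewrite /Useries.
(* The truncated sum in [Useries] runs below |n| = 2k + 2, hence reaches the index k. *)
have hk : (k < `|(- (2 * (k%:Z + 1)))%R|)%N by lia.
rewrite (bigD1 (Ordinal hk)) //= big1 ?addr0 // => l /andP[/eqP h /eqP].
by case; apply: val_inj => /=; lia.
Qed.

Lemma Useries_eq0 (y : nat -> F) (n : int) :
  ~~ ((n < 0) && (2 %| n)%Z) -> Useries y n = 0.
Proof.
move=> h; rewrite /Useries big1 // => k /eqP nE; case/negP: h.
by move: (nat_of_ord k) nE => m ->; lia.
Qed.

Lemma bracket_ser_eq0 a c b d (n : int) :
  ~~ ((n < 0) && (2 %| n)%Z) -> bracket_ser a c b d n = 0.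
Proof.
move=> h.
have h2 : ~~ ((n + 2 < 0) && (2 %| n + 2)%Z) by lia.
by case: a; case: c; case: b; case: d => //=;
  rewrite /ser !Useries_eq0 ?subrr ?scaler0.
Qed.


Hypothesis charK : [pchar K] =i pred0.

Lemma two_neq0 : (2 : K) != 0.
Proof. by rewrite (pcharf0P K).1. Qed.

Lemma expr2_neq0 n : (2 ^+ n : K) != 0.
Proof. by rewrite expf_neq0 ?two_neq0. Qed.

Lemma bracket_ser_even a c b d k l :
  bracket_ser a c b d (- (2 * (k%:Z + 1)) + - (2 * (l%:Z + 1))) =
  2 ^+ (k + l).+2 *: bracket a c b d (k + l).
Proof.
have E1 : - (2 * (k%:Z + 1)) + - (2 * (l%:Z + 1)) =
    - (2 * ((k + l + 1)%N%:Z + 1)).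
  by lia.
have E2 : - (2 * (k%:Z + 1)) + - (2 * (l%:Z + 1)) + 2 =
    - (2 * ((k + l)%N%:Z + 1)).
  by lia.
(* At exponent n + 2 the series of g and g~ carry one power of 2 less; the factor 1/2 in [bracket]
   accounts for it. *)
have E3 : 2 ^+ (k + l).+2 * 2^-1 = 2 ^+ (k + l).+1 :> K.
  by rewrite exprSr mulfK ?two_neq0.
have E4 : 2 ^+ (k + l + 1).+1 = 2 ^+ (k + l).+2 :> K by rewrite addn1.
case: a; case: c; case: b; case: d;
  rewrite /bracket_ser /bracket /ser ?scaler0 //
  ?E2 ?E1 !Useries_even ?E4 ?scalerA ?E3 -?scalerBr //; by rewrite mulrC.
Qed.

Lemma defect_even a c b d k l :
  defect a c b d (- (2 * (k%:Z + 1))) (- (2 * (l%:Z + 1))) =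
  2 ^+ (k + l).+2 *:
    (comm (x (ent a c k)) (x (ent b d l)) - bracket a c b d (k + l)).
Proof.
rewrite /defect ifT; last by lia.
rewrite bracket_ser_even scalerBr; congr (_ - _).
rewrite /ser !Useries_even /comm -!scalerAl -!scalerAr !scalerA -!exprD.
by rewrite !addSn !addnS (addnC l) scalerBr.
Qed.

Lemma defect_eq0 a c b d i j :
  ~~ [&& i < 0, j < 0, (2 %| i)%Z & (2 %| j)%Z] -> defect a c b d i j = 0.
Proof.
move=> h; rewrite /defect (negbTE h) subr0 /comm /ser.
have [hi|hi] := boolP ((i < 0) && (2 %| i)%Z); last first.
  by rewrite (Useries_eq0 _ hi) mul0r mulr0 subrr.
have hj : ~~ ((j < 0) && (2 %| j)%Z) by lia.
by rewrite (Useries_eq0 _ hj) mul0r mulr0 subrr.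
Qed.

(** The bracket part telescopes: i + j - 2 is the same in both terms, and the two guards agree
    unless i = 0 or j = 0. Only these boundary terms survive. *)
Lemma defect_shift a c b d i j :
  defect a c b d (i - 2) j - defect a c b d i (j - 2) =
  comm (ser a c (i - 2)) (ser b d j) - comm (ser a c i) (ser b d (j - 2)) -
  ((if i == 0 then bracket_ser a c b d (j - 2) else 0) -
   (if j == 0 then bracket_ser a c b d (i - 2) else 0)).
Proof.
have sub4 (p q r s : F) : p - q - (r - s) = p - r - (q - s).
  by rewrite opprD addrACA -opprD.
rewrite /defect sub4; congr (_ - _).
have -> : i + (j - 2) = i - 2 + j by lia.
set f := bracket_ser a c b d.
have f0 n : ~~ ((n < 0) && (2 %| n)%Z) -> f n = 0 by exact: bracket_ser_eq0.
(* At i = j = 0 both guards fail and the boundary terms cancel. With exactly one exponent zero,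
   failure of the guard puts the boundary term at an exponent where [bracket_ser] vanishes. *)
have [->|i0] := eqVneq i 0; have [->|j0] := eqVneq j 0.
- by rewrite !subrr.
- rewrite ltxx /= !subr0.
  case: ifP => hj; first by congr f; lia.
  by rewrite f0 //; lia.
- rewrite ltxx andbF !sub0r; congr (- _).
  case: ifP => hi; first by congr f; lia.
  by rewrite f0 //; lia.
- have -> : [&& i - 2 < 0, j < 0, (2 %| i - 2)%Z & (2 %| j)%Z] =
            [&& i < 0, j - 2 < 0, (2 %| i)%Z & (2 %| j - 2)%Z] by lia.
  by rewrite !subrr.
Qed.

End Entries.

(** * Entries of the cleared matrix relation *)

Section ProductEntries.
Variables (K : fieldType) (F : algType K) (x : gen -> F).

(** Boolean indices let every entrywise identity be settled by a finite case analysis that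
    computes. *)
Definition ord_of_bool (a : bool) : 'I_2 := if a then 1 else 0.

Definition idx (a b : bool) : 'I_(2 * 2) :=
  mxtens_index (ord_of_bool a, ord_of_bool b).

Lemma idxP (r : 'I_(2 * 2)) : exists a b, r = idx a b.
Proof.
case: (mxtens_indexP r) => a b.
have ordP (c : 'I_2) : exists c', c = ord_of_bool c'.
  by exists (c == 1); apply: val_inj; case: c => [[|[|//]] ?].
have [a' ->] := ordP a; have [b' ->] := ordP b.
by exists a', b'.
Qed.

Lemma sum_idx (V : zmodType) (f : 'I_(2 * 2) -> V) :
  \sum_t f t = f (idx false false) + f (idx false true) +
              f (idx true false) + f (idx true true).
Proof.
rewrite !big_ord_recl big_ord0 addr0 !addrA.
by do !congr (_ + _); congr f; apply: val_inj.
Qed.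

Lemma rbar_num_idx (R : comNzRingType) (s u v : R) a b c d :
  rbar_num s u v (idx a b) (idx c d) =
  s * (if (a == c) && (b == d) then (if a == b then v ^+ 2 else - v ^+ 2)
       else if (a == d) && (b == c) then 2 * (u * v) else 0).
Proof.
by rewrite /rbar_num !mxE; congr (_ * _); case: a; case: b; case: c; case: d.
Qed.

Definition Bent (a c : bool) (n : int) : F :=
  ent_coef K a c *: ser x a c (n - ent_shift a c).

Lemma BserE a c n : Bser x n (ord_of_bool a) (ord_of_bool c) = Bent a c n.
Proof.
rewrite /Bser /Bent mxE /ent_coef -scalerA; congr (_ *: _).
by case: a; case: c; rewrite /ser /mulu /ent_shift /= ?scale1r ?subr0.
Qed.

Lemma B1_idx i j a b c d :
  B1 x i j (idx a b) (idx c d) =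
  if (j == 0) && (b == d) then Bent a c i else 0.
Proof.
rewrite /B1; case: ifP => _ /=; last by rewrite mxE.
by rewrite tensmxE BserE mxE; case: b; case: d; rewrite ?mulr1 ?mulr0.
Qed.

Lemma B2_idx i j a b c d :
  B2 x i j (idx a b) (idx c d) =
  if (i == 0) && (a == c) then Bent b d j else 0.
Proof.
rewrite /B2; case: ifP => _ /=; last by rewrite mxE.
by rewrite tensmxE BserE mxE; case: a; case: c; rewrite ?mul1r ?mul0r.
Qed.

Lemma commB1B2_idx i j a b c d :
  commB1B2 x i j (idx a b) (idx c d) = comm (Bent a c i) (Bent b d j).
Proof.
rewrite /commB1B2 !mxE !sum_idx !B1_idx !B2_idx /=.
by case: a; case: b; case: c; case: d => /=;
  rewrite ?(mulr0, mul0r, addr0, add0r).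
Qed.

Lemma pscale_u2 S i j : pscale (pu K ^+ 2) S i j = S (i - 2) j :> F.
Proof.
have -> : pu K ^+ 2 = 1%:P%:P * (pu K ^+ 2 * pv K ^+ 0) by rewrite mul1r mulr1.
by rewrite pscaleX scale1r subr0.
Qed.

Lemma pscale_v2 S i j : pscale (pv K ^+ 2) S i j = S i (j - 2) :> F.
Proof.
have -> : pv K ^+ 2 = 1%:P%:P * (pu K ^+ 0 * pv K ^+ 2) by rewrite !mul1r.
by rewrite pscaleX scale1r subr0.
Qed.

Lemma pscale_uv S i j :
  pscale (2 * (pu K * pv K)) S i j = 2 *: S (i - 1) (j - 1) :> F.
Proof.
have -> : 2 * (pu K * pv K) = 2%:P%:P * (pu K ^+ 1 * pv K ^+ 1).
  by rewrite !polyC_natr.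
by rewrite pscaleX.
Qed.

Lemma frt_lhs i j a b c d :
  pmull ((pu K ^+ 2 - pv K ^+ 2)%:M) (commB1B2 x) i j (idx a b) (idx c d) =
  comm (Bent a c (i - 2)) (Bent b d j) - comm (Bent a c i) (Bent b d (j - 2)).
Proof.
rewrite mxE (bigD1 (idx a b)) //= big1 => [|t ht]; last first.
  by rewrite !mxE eq_sym (negbTE ht) pscale0.
by rewrite mxE eqxx addr0 pscaleB pscale_u2 pscale_v2 !commB1B2_idx.
Qed.

Hypothesis charK : [pchar K] =i pred0.

(** The r-matrix terms are exactly the boundary terms of [defect_shift]. The series B_1 lives at j =
    0 and B_2 at i = 0; the entries u^2 and v^2 keep them there, while 2uv moves them to exponent 1,
    matching [ent_shift]. *)
Lemma frt_rhs i j a b c d :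
  ((pmull (rbar_num (-1) (pv K) (pu K)) (B1 x) i j -
    pmulr (B1 x) (rbar_num (-1) (pv K) (pu K)) i j) +
   (pmulr (B2 x) (rbar_num 1 (pu K) (pv K)) i j -
    pmull (rbar_num 1 (pu K) (pv K)) (B2 x) i j)) (idx a b) (idx c d) =
  (ent_coef K a c * ent_coef K b d) *:
  ((if i == ent_shift a c
    then bracket_ser x a c b d (j - ent_shift b d - 2) else 0) -
   (if j == ent_shift b d
    then bracket_ser x a c b d (i - ent_shift a c - 2) else 0)).
Proof.
rewrite /pmull /pmulr !mxE !sum_idx !rbar_num_idx.
have e1 (n : int) : n - 1 - 1 = n - 2 by lia.
have e2 (n : int) : n - 2 - 1 = n - 1 - 2 by lia.
have e3 (n : int) : (n - 1 == 0) = (n == 1) by lia.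
have two0 := two_neq0 charK.
have four0 : (4 : K) != 0 by rewrite (pcharf0P K).1.
have half2 (y : F) : 2^-1 *: y + 2^-1 *: y = y.
  by rewrite -scalerDl (_ : 2^-1 + 2^-1 = 1) ?scale1r //; field.
have double_half (y : F) : 2 *: (2^-1 *: y) = y.
  by rewrite scalerA mulfV ?scale1r.
have double_eighth (y : F) : 2 *: ((2^-1 / 4) *: y) = 4^-1 *: y.
  by rewrite scalerA mulrA mulfV ?mul1r.
have quarter : 2^-1 / 2 = 4^-1 :> K by field; rewrite two0 four0.
(* The structure constant 16 is inverse to 1/8 times 1/2, the product of a diagonal and an
   off-diagonal coefficient of B. *)
have c16 (y : F) : (2^-1 / 4 / 2) *: (16 *: y) = y.
  by rewrite scalerA (_ : _ * 16 = 1) ?scale1r //; field; rewrite two0 four0.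
have c16' (y : F) : (2^-1 * (2^-1 / 4)) *: (16 *: y) = y.
  by rewrite mulrC c16.
have cN16 (y : F) : (2^-1 / 4 / 2) *: (- 16 *: y) = - y.
  by rewrite scaleNr scalerN c16.
have cN16' (y : F) : (2^-1 * (2^-1 / 4)) *: (- 16 *: y) = - y.
  by rewrite scaleNr scalerN c16'.
rewrite ![pv K * pu K]mulrC.
case: a; case: b; case: c; case: d;
  rewrite ?(mulr0, mul0r, mulN1r, mul1r, opprK) /=
    ?(pscale0, pscaleN, pscale_u2, pscale_v2, pscale_uv) !(B1_idx, B2_idx)
    /Bent /ent_shift /= ?andbT ?andbF
    ?(subr0, addr0, add0r, oppr0, opprK, sub0r, scaler0, e3, subrK, e1, e2)
    /ent_coef /= ?mulr1.
all: case: (i == _); case: (j == _);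
  rewrite ?(scaler0, addr0, add0r, subr0, oppr0, sub0r) ?scalerBr
    -?opprD
    ?(half2, double_half, c16, cN16, c16', cN16', double_eighth, quarter)
    ?(subrr, addNr, scaler0, oppr0, addr0, opprK) //.
all: by rewrite ?scalerN ?(c16, cN16, c16', cN16') ?scalerBr ?opprB ?opprK //
  addrC // [X in _ + X]addrC.
Qed.

(** Clearing the denominator determines the numerators uniquely, so the quantified [N12] and [N21]
    may be replaced by the explicit ones. *)
Lemma frt_relP l r : frt_rel x l r <-> exists i j (s t : 'I_(2 * 2)),
  l = pmull ((pu K ^+ 2 - pv K ^+ 2)%:M) (commB1B2 x) i j s t /\
  r = ((pmull (rbar_num (-1) (pv K) (pu K)) (B1 x) i j -
        pmulr (B1 x) (rbar_num (-1) (pv K) (pu K)) i j) +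
       (pmulr (B2 x) (rbar_num 1 (pu K) (pv K)) i j -
        pmull (rbar_num 1 (pu K) (pv K)) (B2 x) i j)) s t.
Proof.
split=> [[N12 N21 i j s t h12 h21]|[i [j [s [t [-> ->]]]]]].
  exists i, j, s, t; rewrite (cleared_inj h12 (cleared_rbar12 K)).
  by rewrite (cleared_inj h21 (cleared_rbar21 K)).
by apply: FRTRel; [exact: cleared_rbar12 | exact: cleared_rbar21].
Qed.

(** The boundary terms of [defect_shift] and [frt_rhs] coincide after a shift absorbing the factor u
    of the off-diagonal entries, which leaves a coefficient of u^2 - v^2 times the defect series. *)
Lemma frt_entry i j a b c d :
  pmull ((pu K ^+ 2 - pv K ^+ 2)%:M) (commB1B2 x) i j (idx a b) (idx c d) -
  ((pmull (rbar_num (-1) (pv K) (pu K)) (B1 x) i j -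
    pmulr (B1 x) (rbar_num (-1) (pv K) (pu K)) i j) +
   (pmulr (B2 x) (rbar_num 1 (pu K) (pv K)) i j -
    pmull (rbar_num 1 (pu K) (pv K)) (B2 x) i j)) (idx a b) (idx c d) =
  (ent_coef K a c * ent_coef K b d) *:
    (defect x a c b d (i - ent_shift a c - 2) (j - ent_shift b d) -
     defect x a c b d (i - ent_shift a c) (j - ent_shift b d - 2)).
Proof.
rewrite frt_lhs frt_rhs defect_shift !subr_eq0 [in RHS]scalerBr.
congr (_ - _); rewrite /Bent /comm ![_ - 2 - ent_shift _ _]addrAC.
by rewrite -!scalerAl -!scalerAr !scalerA [ent_coef K b d * _]mulrC !scalerBr.
Qed.

Lemma ent_coef_neq0 a c : ent_coef K a c != 0.
Proof.
rewrite /ent_coef mulf_neq0 ?invr_neq0 ?(two_neq0 charK) //.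
by case: ifP; rewrite ?oner_eq0 // invr_neq0 // (pcharf0P K).1.
Qed.

End ProductEntries.

(** * The two families of relations generate the same ideal *)

Section Inclusions.
Variable K : fieldType.
Hypothesis charK : [pchar K] =i pred0.

(* Starting from the region i >= 0, where the defect vanishes, the recursion
   extends membership in the ideal to all of the plane. *)
Lemma defect_frt (F : algType K) (x : gen -> F) a c b d i j :
  rel_ideal (frt_rel x) (defect x a c b d i j).
Proof.
have step i' j' : rel_ideal (frt_rel x)
    (defect x a c b d (i' - 2) j' - defect x a c b d i' (j' - 2)).
  apply: (@rel_ideal_scale _ _ _ (ent_coef K a c * ent_coef K b d)).
    by rewrite mulf_neq0 ?ent_coef_neq0.
  have := frt_entry x charK (i' + ent_shift a c) (j' + ent_shift b d) a b c d.
  rewrite !addrK => <-; apply: rel_ideal_rel; apply/frt_relP.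
  by do 4!eexists.
have [n hn] : exists n : nat, 0 <= i + 2 * n%:Z by exists `|i|%N; lia.
elim: n i j hn => [|n IHn] i j hn.
  rewrite defect_eq0; first exact: rel_ideal0.
  by rewrite ltNge -[i]addr0 hn.
have := step (i + 2) j; rewrite addrK => h.
rewrite -[defect _ _ _ _ _ i j](subrK (defect x a c b d (i + 2) (j - 2))).
by apply: rel_idealD => //; apply: IHn; lia.
Qed.

Lemma bracket_frt (F : algType K) (x : gen -> F) a c b d k l :
  rel_ideal (frt_rel x)
    (comm (x (ent a c k)) (x (ent b d l)) - bracket x a c b d (k + l)).
Proof.
apply: (rel_ideal_scale (expr2_neq0 charK (k + l).+2)).
by rewrite -defect_even //; exact: defect_frt.
Qed.

Lemma abar_sub_frt (F : algType K) (x : gen -> F) l r :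
  abar_rel x l r -> rel_ideal (frt_rel x) (l - r).
Proof.
case=> {l r} k l.
- by rewrite addnC; exact: (bracket_frt x true false false true l k).
- exact: (bracket_frt x false false true false k l).
- by rewrite [(k + l)%N]addnC; exact: (bracket_frt x true false true true l k).
- exact: (bracket_frt x false true false false l k).
- by rewrite [(l + k)%N]addnC; exact: (bracket_frt x true true false true k l).
- exact: (bracket_frt x true false true false k l).
- exact: (bracket_frt x false true false true k l).
- exact: (bracket_frt x true true true true k l).
- exact: (bracket_frt x false false false false k l).
Qed.

Lemma comm_opp (R : nzRingType) (y z : R) : comm y z = - comm z y.
Proof. by rewrite /comm opprB. Qed.

Lemma comm_jacobi (R : nzRingType) (u v w : R) :
  comm u (comm v w) = comm (comm u v) w + comm v (comm u w).
Proof.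
rewrite /comm !(mulrBl, mulrBr) !mulrA.
(* The letters stand for the six monomials in u, v, w; e = vuw and f = wuv occur only on the right
   and cancel. *)
have zmodE (a b c d e f : R) :
    a - b - (c - d) = a - e - (f - d) + (e - c - (b - f)).
  by rewrite !opprB [RHS]addrACA !subrKA addrACA [RHS]addrACA [- b - c]addrC.
exact: zmodE.
Qed.

(* The relations do not list [g, g~] = 0: it follows by bracketing g with
   [w_0, w_(l+1)] = (g~ - g) / 2. *)
Lemma abar_comm_g_gt (A : algType K) (y : gen -> A) k l :
  (forall p q, abar_rel y p q -> p = q) -> comm (y (Gg k)) (y (Gt l)) = 0.
Proof.
move=> h.
have ww m n := h _ _ (abar_wm_wp y m n).
have wg m n := h _ _ (abar_wm_g y m n).
have gw m n := h _ _ (abar_g_wp y m n).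
have gg m n := h _ _ (abar_g_g y m n).
have := comm_jacobi (y (Gg k)) (y (Wm 0)) (y (Wp l)).
rewrite ww [comm (y (Gg k)) (y (Wm 0))]comm_opp wg gw.
have commZr (c : K) (u v : A) : comm u (c *: v) = c *: comm u v.
  by rewrite /comm -scalerAr -scalerAl scalerBr.
have commNl (u v : A) : comm (- u) v = - comm u v.
  by rewrite /comm mulNr mulrN opprB opprK addrC.
have commZl (c : K) (u v : A) : comm (c *: u) v = c *: comm u v.
  by rewrite comm_opp commZr -scalerN -comm_opp.
have commBr (u v w : A) : comm u (v - w) = comm u v - comm u w.
  by rewrite /comm mulrBr mulrBl !opprD addrACA.
rewrite !commZr commNl commZl !ww.
(* The two Jacobi terms are multiples of g~ - g by opposite scalars; once their indices agree they
   cancel. *)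
have -> : (l + (k + 0 + 1) = l + k + 1 + 0)%N by lia.
rewrite addNr commBr gg subr0 addn0 => /eqP.
by rewrite scaler_eq0 invr_eq0 (negbTE (two_neq0 charK)) => /eqP.
Qed.

Notation pi := (fun p => \pi_(quot_alg (@abar_proper K)) p).

Lemma abar_piB (p q : falg K gen) : pi (p - q) = pi p - pi q.
Proof. by apply: (addIr (pi q)); rewrite -quot_piD !subrK. Qed.

Lemma abar_pi_comm (p q : falg K gen) : pi (comm p q) = comm (pi p) (pi q).
Proof. by rewrite /comm abar_piB; congr (_ - _); exact: quot_piM. Qed.

(** In the quotient the relations become equalities, which lets the Jacobi argument proceed by
    rewriting. *)
Lemma abar_gen_rel l r : abar_rel (@abar_gen K) l r -> l = r.
Proof.
have E p q : abar_rel (@fgen K gen) p q -> pi p = pi q.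
  by move=> h; apply/pi_eqP/rel_ideal_rel.
case=> {l r} k l; rewrite /abar_gen /quot_gen -abar_pi_comm.
- by rewrite (E _ _ (abar_wm_wp _ k l)) quot_piZ abar_piB.
- by rewrite (E _ _ (abar_gt_wm _ k l)) quot_piZ.
- by rewrite (E _ _ (abar_wm_g _ k l)) quot_piZ.
- by rewrite (E _ _ (abar_wp_gt _ k l)) quot_piZ.
- by rewrite (E _ _ (abar_g_wp _ k l)) quot_piZ.
- by rewrite (E _ _ (abar_wm_wm _ k l)).
- by rewrite (E _ _ (abar_wp_wp _ k l)).
- by rewrite (E _ _ (abar_g_g _ k l)).
- by rewrite (E _ _ (abar_gt_gt _ k l)).
Qed.

Notation x := (@fgen K gen).

Lemma bracket_abar a c b d k l :
  rel_ideal (abar_rel x)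
    (comm (x (ent a c k)) (x (ent b d l)) - bracket x a c b d (k + l)).
Proof.
(* Each mixed commutator is listed in one order only; antisymmetry supplies the other. *)
have swap u v z : rel_ideal (abar_rel x) (comm u v - z) ->
    rel_ideal (abar_rel x) (comm v u - - z).
  by rewrite [comm v u]comm_opp -opprD; exact: rel_idealN.
have ggt m n : rel_ideal (abar_rel x) (comm (x (Gg m)) (x (Gt n)) - 0).
  rewrite subr0 -[comm _ _]subr0; apply/(pi_eqP (@abar_proper K)).
  by rewrite abar_pi_comm; exact: (abar_comm_g_gt m n abar_gen_rel).
case: a; case: c; case: b; case: d; rewrite /ent /bracket ?scaleNr.
- exact/rel_ideal_rel/abar_g_g.
- by apply/swap/rel_ideal_rel; exact: abar_wm_g.
- by rewrite [(k + l)%N]addnC; apply/rel_ideal_rel; exact: abar_g_wp.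
- exact: ggt.
- by rewrite [(k + l)%N]addnC; apply/rel_ideal_rel; exact: abar_wm_g.
- exact/rel_ideal_rel/abar_wm_wm.
- by rewrite addnC; apply/rel_ideal_rel; exact: abar_wm_wp.
- by rewrite [(k + l)%N]addnC; apply/swap/rel_ideal_rel; exact: abar_gt_wm.
- by apply/swap/rel_ideal_rel; exact: abar_g_wp.
- by rewrite -[x (Gg _) - _]opprB scalerN; apply/swap/rel_ideal_rel;
  exact: abar_wm_wp.
- exact/rel_ideal_rel/abar_wp_wp.
- exact/rel_ideal_rel/abar_wp_gt.
- by rewrite -oppr0; apply/swap/ggt.
- exact/rel_ideal_rel/abar_gt_wm.
- by rewrite [(k + l)%N]addnC; apply/swap/rel_ideal_rel; exact: abar_wp_gt.
- exact/rel_ideal_rel/abar_gt_gt.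
Qed.

Lemma defect_abar a c b d i j :
  rel_ideal (abar_rel x) (defect x a c b d i j).
Proof.
have [h|h] := boolP [&& i < 0, j < 0, (2 %| i)%Z & (2 %| j)%Z]; last first.
  by rewrite defect_eq0 //; exact: rel_ideal0.
have [k ->] : exists k : nat, i = - (2 * (k%:Z + 1)).
  by exists (`|i|%N %/ 2).-1; lia.
have [l ->] : exists l : nat, j = - (2 * (l%:Z + 1)).
  by exists (`|j|%N %/ 2).-1; lia.
by rewrite defect_even //; apply/rel_idealZ/bracket_abar.
Qed.

Lemma frt_sub_abar l r :
  frt_rel x l r -> rel_ideal (abar_rel x) (l - r).
Proof.
move=> /frt_relP [i [j [s [t [-> ->]]]]].
have [a [b ->]] := idxP s; have [c [d ->]] := idxP t.
rewrite frt_entry //.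
by apply/rel_idealZ/rel_idealB; exact: defect_abar.
Qed.

End Inclusions.

Theorem proposition3p6 (K : closedFieldType) (charK : [pchar K] =i pred0) :
  presented_by (frt_rel (@fgen K gen)) (@abar_gen K).
Proof.
have [gen_abar ker_abar] := abar_presented K.
(* Generation does not depend on the relations, so only the equality of the two ideals remains. *)
split=> [//|p]; apply: iff_trans (ker_abar p) _.
split; apply: rel_ideal_sub => l r.
  exact: abar_sub_frt.
exact: frt_sub_abar.
Qed.
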